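(* Let $p$ be a positive integer, let $T$ be a complete rooted ternary tree, let $H$ be a connected graph with at least $2p$ vertices, and let $V\subseteq V(T(H))$ with $|OC(T,V)|\geq p$. Let $x=tr(|OC(T,V)|)$ and let $SV$ be an ordering (permutation) of $V$. Then $T(H)$ has a witnessing matching for $SV$ of size at least $p\cdot\lfloor (x-tr(p))/2\rfloor$.
   Context: Complete rooted ternary tree of height $h$: a rooted tree in which every root-leaf path has exactly $h$ edges and every non-leaf vertex has exactly 3 children. For real $x\geq 1$, $tr(x)$ is the largest integer $h\geq 0$ such that a complete rooted ternary tree of height $h$ has at most $x$ vertices. Graph $T(H)$: for a tree $T$ and a graph $H$ with $V(H)=\{1,\dots,m\}$, $T(H)$ has vertex set $\{v^i: v\in V(T), 1\le i\le m\}$; for each $v\in V(T)$ the vertices $v^1,\dots,v^m$ span a copy $H^v$ of $H$ ($v^iv^j$ is an edge iff $ij\in E(H)$), and additionally $u^iv^i$ is an edge for each $i$ whenever $uv\in E(T)$. For $V\subseteq V(T(H))$, $OC(T,V)=\{u\in V(T): V(H^u)\cap V\neq\emptyset\}$. Witnessing matching: let $G$ be a graph, $V\subseteq V(G)$ and $SV$ an ordering of $V$. A partition of $SV$ into a prefix $SV_1$ and a suffix $SV_2$ (either may be empty) supports an edge $\{u,v\}$ if either one endpoint lies in $SV_1$ and the other in $SV_2$, or one endpoint lies in $V$ and the other in $V(G)\setminus V$. A matching $M$ of $G$ is witnessing for $SV$ if some partition of $SV$ into a prefix and a suffix supports every edge of $M$. *)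

(* Defs.v *)
From mathcomp Require Import all_boot.
Set Implicit Arguments. Unset Strict Implicit. Unset Printing Implicit Defensive.

(* Vertices of the complete rooted ternary tree of height h: words over
   {0,1,2} of length at most h; the empty word is the root, the children of
   w are w++[c] for c in {0,1,2}. *)
Definition TV (h : nat) : finType := {k : 'I_h.+1 & k.-tuple 'I_3}.

Definition word (h : nat) (u : TV h) : seq 'I_3 := val (tagged u).

Definition parent (h : nat) (u v : TV h) : bool :=
  (size (word v) == (size (word u)).+1) && (word u == take (size (word u)) (word v)).

Definition Tadj (h : nat) : rel (TV h) := fun u v => parent u v || parent v u.

(* vertices of T(H): pairs (v, i) standing for v^i, with H on vertex set 'I_m *)
Definition TH (h m : nat) : finType := (TV h * 'I_m)%type.

Definition THadj (h m : nat) (eH : rel 'I_m) : rel (TH h m) :=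
  fun x y => ((x.1 == y.1) && eH x.2 y.2) || ((x.2 == y.2) && Tadj x.1 y.1).

Definition OC (h m : nat) (V : {set TH h m}) : {set TV h} :=
  [set u | [exists i : 'I_m, (u, i) \in V]].

(* number of vertices of the complete rooted ternary tree of height k *)
Definition ternary_size (k : nat) : nat := \sum_(i < k.+1) 3 ^ i.

(* tr n = largest k with ternary_size k <= n (k <= n automatically) *)
Definition tr (n : nat) : nat := \max_(k < n.+1 | ternary_size k <= n) k.

Definition is_matching (W : finType) (adj : rel W) (M : {set {set W}}) : Prop :=
  (forall e, e \in M -> exists u v, adj u v /\ e = [set u; v]) /\
  (forall e1 e2, e1 \in M -> e2 \in M -> e1 != e2 -> [disjoint e1 & e2]).

Definition supports (W : finType) (V : {set W}) (s : seq W) (k : nat) (u v : W) : bool :=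
  [|| (u \in take k s) && (v \in drop k s),
      (v \in take k s) && (u \in drop k s),
      (u \in V) && (v \notin V)
    | (v \in V) && (u \notin V)].

Definition witnessing (W : finType) (adj : rel W) (V : {set W}) (s : seq W)
  (M : {set {set W}}) : Prop :=
  is_matching adj M /\
  exists k, k <= size s /\
    forall e, e \in M -> forall u v, e = [set u; v] -> supports V s k u v.

(* Main.v *)
(** Fix a cut of the ordering and colour the vertices of [T(H)] by prefix, suffix
    and complement of [V]; the supported edges are the bichromatic ones.  By
    induction on [d], every full subtree [W] of [T] meeting [OC V] in at least
    [2 p 4^d] vertices has a cut with [p (d + 1)] disjoint bichromatic edges
    inside [W(H)], such that the prefix and the suffix each meet at least [p]
    copies of [H] over [W].  For the step with threshold [n = 2 p 4^d], take a
    deepest [v] below the root of [W] whose subtree [W_v] meets [OC V] in at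
    least [n] vertices; it meets it in fewer than [3 n].  If [W - W_v] contains a
    vertex outside [OC V], then [p] edges between [V] and its complement appear
    over [W - W_v], to be added to those over [W_v].  Otherwise the subtrees of
    the two siblings of [v] lie inside [OC V], hence also have weight at least
    [n]; among the three cuts obtained for [v] and its siblings choose the middle
    one: the other two subtrees then have [p] copies meeting the prefix and [p]
    copies meeting the suffix, and they are joined outside the middle subtree,
    which gives [p] more edges. *)
Require Import Defs.
From mathcomp Require Import all_boot.
From mathcomp Require Import zify.
Set Implicit Arguments. Unset Strict Implicit. Unset Printing Implicit Defensive.

(** * Subtrees of the ternary tree as sets of words *)

Lemma size_word h (u : TV h) : size (word u) <= h.
Proof. by rewrite /word size_tuple -ltnS ltn_ord. Qed.

Lemma word_inj h : injective (@word h).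
Proof.
move=> [i s] [j t]; rewrite /word /= => e.
have eij : i = j by apply: val_inj; rewrite /= -(size_tuple s) -(size_tuple t) e.
by case: j / eij t e => t e; congr existT; apply: val_inj.
Qed.

Lemma word_surj h (t : seq 'I_3) : size t <= h -> exists u : TV h, word u = t.
Proof.
move=> le_th; have lt_th : size t < h.+1 by [].
by exists (existT (fun k : 'I_h.+1 => k.-tuple 'I_3) (Ordinal lt_th) (in_tuple t)).
Qed.

Lemma connect_crossing (T : finType) (e : rel T) (f : pred T) (x y : T) :
  connect e x y -> f x != f y -> exists a b, e a b /\ f a != f b.
Proof.
case/connectP=> q; elim: q x => [|z q IH] x /=; first by move=> _ ->; rewrite eqxx.
case/andP=> exz pq ey nfxy; case: (boolP (f x == f z)) => [/eqP fxz | nf].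
  by apply: (IH z) => //; rewrite -fxz.
by exists x, z.
Qed.

Definition subtree h (w : TV h) : {set TV h} := [set u | prefix (word w) (word u)].

(** Connectivity of [D] in a form suited to induction on depth: from every vertex, steps to the
    parent stay in [D] and end at [r]. *)
Definition rooted h (r : TV h) (D : {set TV h}) :=
  r \in D /\ forall u, u \in D -> u != r -> exists2 v, v \in D & parent v u.

(** One of [x] and [y] differs from [r] under [f]; on the way up from it to [r] the value changes at
    some edge. *)
Lemma rooted_crossing h (r : TV h) (D : {set TV h}) (f : pred (TV h)) x y :
  rooted r D -> x \in D -> y \in D -> f x != f y ->
  exists a b, [/\ a \in D, b \in D, Tadj a b & f a != f b].
Proof.
move=> [rD pD] xD yD.
suff H z : z \in D -> f z != f r ->
    exists a b, [/\ a \in D, b \in D, Tadj a b & f a != f b].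
  move=> nf; case: (boolP (f x == f r)) => [/eqP e|]; last exact: H.
  by apply: (H y yD); rewrite -e eq_sym.
have [n] := ubnP (size (word z)); elim: n z => // n IH z lt_zn zD nf.
have zr : z != r by apply: contraNneq nf => ->.
have [v vD pvz] := pD z zD zr.
case: (boolP (f v == f z)) => [/eqP e|nfvz].
  apply: (IH v) => //; last by rewrite e.
  by case/andP: pvz => /eqP sz _; rewrite sz in lt_zn.
by exists v, z; rewrite /Tadj pvz.
Qed.

Lemma subtree_rooted h (w : TV h) : rooted w (subtree w).
Proof.
split=> [|u]; first by rewrite inE prefix_refl.
rewrite inE => /prefixP[t et] nuw.
case/lastP: t et => [|t c et].
  by rewrite cats0 => /word_inj euw; rewrite euw eqxx in nuw.
have [v ev] : exists v : TV h, word v = word w ++ t.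
  apply: word_surj; apply: leq_trans (size_word u).
  by rewrite et size_cat size_cat size_rcons; lia.
exists v; first by rewrite inE ev prefix_prefix.
rewrite /parent ev et -rcons_cat size_rcons eqxx /=.
by rewrite -cats1 take_size_cat.
Qed.

Lemma subtree_trans h (u v w : TV h) : u \in subtree v -> v \in subtree w -> u \in subtree w.
Proof. by rewrite !inE => uv /prefix_trans; apply. Qed.

Lemma parent_subtree h (u v w : TV h) : parent v u -> v \in subtree w -> u \in subtree w.
Proof.
case/andP=> _ /eqP e; apply: subtree_trans; rewrite inE e; exact: prefix_take.
Qed.

Lemma subtree_refl h (w : TV h) : w \in subtree w.
Proof. by rewrite inE prefix_refl. Qed.

Lemma subtree_anti h (v w : TV h) : v \in subtree w -> w \in subtree v -> v = w.
Proof.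
rewrite !inE => wv vw; apply: word_inj.
have sz : size (word v) = size (word w).
  by apply/eqP; rewrite eqn_leq !size_prefix.
by move: vw; rewrite prefixE sz take_size => /eqP.
Qed.

(** A child of a vertex of [subtree v] is again in [subtree v], so a parent step cannot enter it
    from outside. *)
Lemma subtreeD_rooted h (w v : TV h) :
  v \in subtree w -> v != w -> rooted w (subtree w :\: subtree v).
Proof.
have [ww pw] := subtree_rooted w.
move=> vw nvw; split=> [|u].
  by rewrite inE ww andbT; apply: contraNN nvw => wv; rewrite (subtree_anti vw wv).
rewrite inE => /andP[nuv uw] nuw; have [x xw pxu] := pw u uw nuw.
by exists x => //; rewrite inE xw andbT; apply: contraNN nuv; apply: parent_subtree.
Qed.

Lemma disjoint_subtree h (a b : TV h) :
  size (word a) = size (word b) -> a != b -> [disjoint subtree a & subtree b].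
Proof.
move=> sz nab; rewrite -setI_eq0; apply/set0Pn => -[u]; rewrite !inE !prefixE sz.
case/andP=> /eqP ea /eqP eb; case/negP: nab; apply/eqP/word_inj.
exact: etrans (esym ea) eb.
Qed.

(** Replacing the prefix [word a] by [word b] is injective and keeps the length, hence stays within
    height [h]. *)
Lemma card_subtree_le h (a b : TV h) :
  size (word a) = size (word b) -> #|subtree a| <= #|subtree b|.
Proof.
move=> sz.
pose t (u : TV h) := word b ++ drop (size (word a)) (word u).
(* The default [u] is never taken on [subtree a], where [t u] is the word of a vertex. *)
pose f (u : TV h) := odflt u [pick u' | word u' == t u].
have wf u : u \in subtree a -> word (f u) = t u.
  rewrite inE => /size_prefix le_au; rewrite /f; case: pickP => [x /eqP|] //=.
  have [x <-] : exists x : TV h, word x = t u.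
    apply: word_surj; rewrite /t size_cat size_drop -sz subnKC //; exact: size_word.
  by move/(_ x); rewrite eqxx.
have f_inj : {in subtree a &, injective f}.
  move=> u v ua va /(congr1 (@word h)); rewrite !wf // => /eqP.
  rewrite eqseq_cat // eqxx => /eqP e; apply: word_inj.
  move: ua va; rewrite !inE !prefixE => /eqP ua /eqP va.
  by rewrite -(cat_take_drop (size (word a)) (word u)) ua e -{1}va cat_take_drop.
rewrite -(card_in_imset f_inj); apply: subset_leq_card.
apply/subsetP=> _ /imsetP[u ua ->]; rewrite inE wf //; exact: prefix_prefix.
Qed.

Lemma card_setI_subtree h (X : {set TV h}) (v : TV h) n :
  (forall w, parent v w -> #|X :&: subtree w| <= n) -> #|X :&: subtree v| <= 3 * n + 1.
Proof.
move=> le_n.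
(* Defined through the word of the child, since a leaf has no children; [U c] is then empty. *)
pose U c : {set TV h} := [set u | prefix (rcons (word v) c) (word u)].
have leU c : #|X :&: U c| <= n.
  case: (leqP (size (rcons (word v) c)) h) => [/word_surj[w ew]|lt_h].
    have -> : U c = subtree w by apply/setP => u; rewrite !inE ew.
    by apply: le_n; rewrite /parent ew size_rcons eqxx -cats1 take_size_cat /=.
  suff -> : U c = set0 by rewrite setI0 cards0.
  apply/setP=> u; rewrite !inE; apply/negbTE; apply: contraL lt_h => /size_prefix.
  by rewrite -leqNgt => le_u; apply: leq_trans le_u (size_word u).
have sUv : X :&: subtree v \subset
    v |: (\bigcup_(c : 'I_3) (X :&: U c)).
  apply/subsetP => u; rewrite !inE => /andP[uX /prefixP[[|c q] euv]].
    by rewrite cats0 in euv; rewrite (word_inj euv) eqxx.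
  apply/orP; right; apply/bigcupP; exists c => //.
  by rewrite !inE uX euv -cat_rcons prefix_prefix.
apply: leq_trans (subset_leq_card sUv) _.
apply: leq_trans (leq_card_setU _ _) _; rewrite cards1 addnC leq_add2r.
rewrite !big_ord_recl big_ord0 setU0.
rewrite mulSn; apply: leq_trans (leq_card_setU _ _) (leq_add (leU _) _).
rewrite mul2n -addnn; exact: leq_trans (leq_card_setU _ _) (leq_add (leU _) (leU _)).
Qed.

(** At a deepest vertex of weight above [n], the three child subtrees weigh at most [n] each and the
    vertex itself at most 1. *)
Lemma deepest_heavy h (X : {set TV h}) (w : TV h) n : n < #|X :&: subtree w| ->
  exists2 v, v \in subtree w & n < #|X :&: subtree v| <= 3 * n + 1.
Proof.
move=> heavy_w.
pose Q v := (v \in subtree w) && (n < #|X :&: subtree v|).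
have Qw : Q w by rewrite /Q subtree_refl.
case: (arg_maxnP (fun v => size (word v)) Qw) => v /andP[vw heavy_v] max_v.
exists v => //; rewrite heavy_v; apply: card_setI_subtree => u pvu; rewrite leqNgt.
apply/negP=> heavy_u; have := max_v u; rewrite /Q heavy_u (parent_subtree pvu vw) => /(_ isT).
by case/andP: pvu => /eqP-> _; rewrite /geq /= ltnn.
Qed.

Lemma siblings h (v w : TV h) : v \in subtree w -> v != w ->
  exists a b, [/\ a \in subtree w, b \in subtree w,
    size (word a) = size (word v), size (word b) = size (word v)
    & uniq [:: v; a; b]].
Proof.
rewrite inE => /prefixP[q]; case/lastP: q => [|q c] ev nvw.
  by move: ev; rewrite cats0 => /word_inj e; rewrite e eqxx in nvw.
have [c1 [c2 uc]] : exists c1 c2, uniq [:: c; c1; c2].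
  case: c {ev} => [[|[|[|//]]] lt_c3].
  - by exists (@Ordinal 3 1 isT), (@Ordinal 3 2 isT).
  - by exists (@Ordinal 3 0 isT), (@Ordinal 3 2 isT).
  - by exists (@Ordinal 3 0 isT), (@Ordinal 3 1 isT).
have sib d : exists u : TV h, word u = word w ++ rcons q d.
  apply: word_surj.
  by rewrite size_cat size_rcons -(size_rcons q c) -size_cat -ev size_word.
have [[a ea] [b eb]] := (sib c1, sib c2).
exists a, b; split; rewrite ?inE ?ea ?eb ?prefix_prefix //.
- by rewrite ev !size_cat !size_rcons.
- by rewrite ev !size_cat !size_rcons.
rewrite -(map_inj_uniq (@word_inj h)) /= ev ea eb -!rcons_cat.
move: uc; rewrite /= !inE !eqseq_rcons. 
by rewrite !eqxx.
Qed.

Lemma disjoint_setDr (T : finType) (A B : {set T}) : [disjoint B & A :\: B].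
Proof. by rewrite disjoint_sym; move: (subxx (A :\: B)); rewrite subsetD => /andP[]. Qed.

(** * Matchings of supported edges over a part of the tree *)

Section WitnessingMatching.
Variables (p h m : nat) (eH : rel 'I_m).
Hypothesis hconn : forall i j : 'I_m, connect eH i j.
Hypotheses (p_gt0 : 0 < p) (le_pm : p <= m).
Variables (V : {set TH h m}) (s : seq (TH h m)).
Hypotheses (hsu : uniq s) (hsV : s =i V).

Definition edge_in k (D : {set TV h}) (a b : TH h m) :=
  [&& THadj eH a b, supports V s k a b, a.1 \in D & b.1 \in D].

Definition packing k (D : {set TV h}) (M : {set {set TH h m}}) :=
  (forall e, e \in M -> exists a b, edge_in k D a b /\ e = [set a; b]) /\
  (forall e1 e2, e1 \in M -> e2 \in M -> e1 != e2 -> [disjoint e1 & e2]).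

(** The analogue of [OC] within [D] for an arbitrary set [P] of vertices of [T(H)]. *)
Definition touch (D : {set TV h}) (P : pred (TH h m)) : {set TV h} :=
  [set u in D | [exists i, P (u, i)]].

Lemma packing_sub k D (M : {set {set TH h m}}) e x :
  packing k D M -> e \in M -> x \in e -> x.1 \in D.
Proof.
case=> edgeM _ /edgeM[a [b [/and4P[_ _ aD bD] ->]]].
by rewrite !inE => /orP[] /eqP->.
Qed.

Lemma packingU k (D D1 D2 : {set TV h}) M1 M2 :
  D1 \subset D -> D2 \subset D -> [disjoint D1 & D2] ->
  packing k D1 M1 -> packing k D2 M2 ->
  packing k D (M1 :|: M2) /\ #|M1 :|: M2| = #|M1| + #|M2|.
Proof.
move=> sD1 sD2 dD pM1 pM2.
have [[edgeM1 disjM1] [edgeM2 disjM2]] := (pM1, pM2).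
have disj12 e1 e2 : e1 \in M1 -> e2 \in M2 -> [disjoint e1 & e2].
  move=> e1M e2M; rewrite -setI_eq0; apply/set0Pn=> -[x]; rewrite inE => /andP[x1 x2].
  have := disjointFr dD (packing_sub pM1 e1M x1).
  by rewrite (packing_sub pM2 e2M x2).
have widen (D' : {set TV h}) (e : {set TH h m}) : D' \subset D ->
    (exists a b, edge_in k D' a b /\ e = [set a; b]) ->
    exists a b, edge_in k D a b /\ e = [set a; b].
  move=> /subsetP sD' [a [b [/and4P[ab sab aD bD] ->]]].
  by exists a, b; split=> //; apply/and4P; split=> //; apply: sD'.
split; last first.
  (* The sizes add up because a common edge would be disjoint from itself, although it contains an
     endpoint. *)
  apply/eqP; rewrite -[_ == _]negbK; apply/negP=> neq.
  have : M1 :&: M2 != set0 by rewrite -cards_eq0; move: neq; rewrite cardsU; lia.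
  case/set0Pn=> e; rewrite inE => /andP[e1 e2]; have := disj12 e e e1 e2.
  have [a [b [_ eE]]] := edgeM1 e e1.
  by rewrite -setI_eq0 setIid eE => /eqP/setP/(_ a); rewrite !inE eqxx.
split=> [e | e1 e2].
  by rewrite inE => /orP[/edgeM1 | /edgeM2]; apply: widen.
rewrite !inE => /orP[] e1M /orP[] e2M ne; [exact: disjM1 | exact: disj12 | | exact: disjM2].
by rewrite disjoint_sym; apply: disj12.
Qed.

(** Edges whose endpoints carry different labels are disjoint. The label is [fst] for edges inside
    copies of [H] and [snd] for edges inside the parallel copies of [T]. *)
Lemma packing_of_labels (I : finType) (loc : TH h m -> I) (J : {set I}) k D :
  (forall i, i \in J -> exists a b, [/\ edge_in k D a b, loc a = i & loc b = i]) ->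
  exists M, packing k D M /\ #|M| = #|J|.
Proof.
move=> ex_edge.
pose good i (ab : TH h m * TH h m) :=
  [&& edge_in k D ab.1 ab.2, loc ab.1 == i & loc ab.2 == i].
pose e i : {set TH h m} :=
  if [pick ab | good i ab] is Some ab then [set ab.1; ab.2] else set0.
have eP i : i \in J -> exists a b,
    [/\ edge_in k D a b, loc a = i, loc b = i & e i = [set a; b]].
  move=> iJ; rewrite /e; case: pickP => [[a b] /and3P[/= ab /eqP la /eqP lb]|no].
    by exists a, b.
  have [a [b [ab la lb]]] := ex_edge i iJ.
  by have := no (a, b); rewrite /good /= ab la lb !eqxx.
have loc_e i x : i \in J -> x \in e i -> loc x = i.
  by move/eP=> [a [b [_ la lb ->]]]; rewrite !inE => /orP[] /eqP->.
have e_inj : {in J &, injective e}.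
  move=> i j iJ jJ eij; have [a [b [_ la _ ei]]] := eP i iJ.
  have aei : a \in e i by rewrite ei !inE eqxx.
  by rewrite -la; apply: loc_e => //; rewrite -eij.
exists (e @: J); split; last exact: card_in_imset.
split=> [_ /imsetP[i iJ ->] | _ _ /imsetP[i iJ ->] /imsetP[j jJ ->] ne].
  by have [a [b [ab _ _ ->]]] := eP i iJ; exists a, b.
rewrite -setI_eq0; apply/set0Pn=> -[x]; rewrite inE => /andP[xi xj].
by case/eqP: ne; rewrite -(loc_e i x) // (loc_e j x).
Qed.

(* Each copy of [H] meeting both [P] and its complement contains a crossing
   edge; with fewer than [p] such copies there is one inside [P] and one
   outside, and the [m] parallel paths joining them all cross. *)
Lemma crossing_packing k (r : TV h) (D : {set TV h}) (P : pred (TH h m)) :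
  (forall a b, P a != P b -> supports V s k a b) ->
  rooted r D -> p <= #|touch D P| ->
  (p <= #|touch D (predC P)| \/ exists2 u, u \in D & forall i, ~~ P (u, i)) ->
  exists M, packing k D M /\ p <= #|M|.
Proof.
move=> suppP rD pP pNP.
pose X := touch D P :&: touch D (predC P).
case: (leqP p #|X|) => [le_pX | lt_Xp].
  have [|M [pM cM]] := @packing_of_labels _ fst X k D; last by exists M; rewrite cM.
  move=> u; rewrite !inE.
  case/andP=> /andP[uD /existsP[i Pi]] /andP[_ /existsP[j /= NPj]].
  have [|i' [j' [eij nP]]] := @connect_crossing _ _ (fun l => P (u, l)) _ _ (hconn i j).
    by rewrite Pi (negbTE NPj).
  exists (u, i'), (u, j'); split=> //.
  by rewrite /edge_in /= uD suppP // /THadj /= eqxx eij.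
have pure Q : p <= #|touch D Q| -> exists2 u, u \in touch D Q & u \notin X.
  move=> le_pQ; have : ~~ (touch D Q \subset X).
    by apply/negP=> /subset_leq_card; lia.
  by case/subsetPn=> u; exists u.
have [u uP uX] := pure _ pP.
have [uD Pu] : u \in D /\ forall i, P (u, i).
  move: uP uX; rewrite !inE => /andP[uD ->]; rewrite uD /= negb_exists => /forallP Pu.
  by split=> // i; have := Pu i; rewrite /= negbK.
have [v vD NPv] : exists2 v, v \in D & forall i, ~~ P (v, i).
  case: pNP => // /pure[v]; rewrite !inE => /andP[vD ->]; rewrite vD /= andbT negb_exists => /forallP.
  by exists v.
have [|M [pM cM]] := @packing_of_labels _ snd [set: 'I_m] k D; last first.
  by exists M; rewrite cM cardsT card_ord.
move=> i _.
have [|a [b [aD bD ab nP]]] := @rooted_crossing _ r D (fun x => P (x, i)) u v rD uD vD.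
  by rewrite Pu (negbTE (NPv i)).
exists (a, i), (b, i); split=> //.
by rewrite /edge_in /= aD bD suppP // /THadj /= eqxx ab orbT.
Qed.

Lemma supports_V k a b : (a \in V) != (b \in V) -> supports V s k a b.
Proof. by rewrite /supports; case: (a \in V); case: (b \in V); rewrite ?orbT. Qed.

(** The endpoint outside the prefix lies either in the suffix or outside [V], and both cases are
    supported. *)
Lemma supports_take k a b :
  (a \in take k s) != (b \in take k s) -> supports V s k a b.
Proof.
have split_V x : (x \in V) = (x \in take k s) || (x \in drop k s).
  by rewrite -hsV -mem_cat cat_take_drop.
rewrite /supports !split_V.
by do 4!case: (_ \in _).
Qed.

Lemma touchS (D D' : {set TV h}) (P Q : pred (TH h m)) :
  D \subset D' -> (forall x, P x -> Q x) -> touch D P \subset touch D' Q.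
Proof.
move=> /subsetP sD sPQ; apply/subsetP=> u; rewrite !inE => /andP[/sD-> /existsP[i Pi]].
by apply/existsP; exists i; apply: sPQ.
Qed.

Lemma touch_V D : touch D (mem V) = OC V :&: D.
Proof. by apply/setP=> u; rewrite !inE andbC. Qed.

(** * Balanced cuts of the ordering *)

Definition balanced k (D : {set TV h}) :=
  (p <= #|touch D (mem (take k s))|) && (p <= #|touch D (mem (drop k s))|).

Lemma drop_notin_take k x : x \in drop k s -> x \notin take k s.
Proof.
move=> xd; move: hsu; rewrite -{1}(cat_take_drop k s) cat_uniq.
by case/and3P=> _ /hasPn/(_ x xd).
Qed.

Lemma take_sub k k' : k <= k' -> {subset take k s <= take k' s}.
Proof. by move=> le_kk' x; rewrite -(take_takel s le_kk') => /mem_take. Qed.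

Lemma drop_sub k k' : k <= k' -> {subset drop k' s <= drop k s}.
Proof. by move=> le_kk' x; rewrite -(subnK le_kk') -drop_drop => /mem_drop. Qed.

Lemma touch_take_le k k' (D D' : {set TV h}) : k <= k' -> D \subset D' ->
  #|touch D (mem (take k s))| <= #|touch D' (mem (take k' s))|.
Proof. by move=> kk' sD; apply/subset_leq_card/touchS => //; apply: take_sub. Qed.

Lemma touch_drop_le k k' (D D' : {set TV h}) : k <= k' -> D \subset D' ->
  #|touch D (mem (drop k' s))| <= #|touch D' (mem (drop k s))|.
Proof. by move=> kk' sD; apply/subset_leq_card/touchS => //; apply: drop_sub. Qed.

(** Take the shortest prefix touching [p] copies. Each further entry touches at most one new copy,
    so this prefix touches exactly [p], and the suffix must touch the other copies, at least [p] in
    number. *)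
Lemma exists_balanced D : 2 * p <= #|OC V :&: D| ->
  exists2 k, k <= size s & balanced k D.
Proof.
move=> le_2p; pose f k := #|touch D (mem (take k s))|.
have full : p <= f (size s).
  apply: leq_trans (_ : #|OC V :&: D| <= _); first lia.
  rewrite -touch_V; apply/subset_leq_card/touchS => // x.
  by rewrite /= take_size hsV.
have ex_k : exists k, p <= f k by exists (size s).
case: (ex_minnP ex_k) => k le_p min_k.
exists k; first exact: min_k.
rewrite /balanced le_p /=.
have f_le : f k <= p.
  case: k min_k {le_p} => [|k] min_k.
    rewrite /f take0 (_ : touch _ _ = set0) ?cards0 //.
    by apply/setP=> u; rewrite !inE; apply/negP=> /andP[_ /existsP[]].
  have lt_k : f k < p by rewrite ltnNge; apply/negP=> /min_k; rewrite ltnn.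
  apply: leq_trans lt_k; rewrite /f.
  case: (ltnP k (size s)) => [lt_ks | le_sk]; last first.
    by rewrite !take_oversize //; lia.
  have x0 : TH h m by case: (s) lt_ks.
  rewrite (take_nth x0) //.
  apply: leq_trans (_ : #|(nth x0 s k).1 |: touch D (mem (take k s))| <= _).
    apply/subset_leq_card/subsetP=> u; rewrite !inE => /andP[uD /existsP[i]].
    rewrite /= mem_rcons inE => /orP[/eqP<- | ui]; first by rewrite eqxx.
    by rewrite uD /= orbC; apply/orP; left; apply/existsP; exists i.
  by rewrite cardsU1 -add1n leq_add2r leq_b1.
have : #|touch D (mem V)| <= f k + #|touch D (mem (drop k s))|.
  apply: leq_trans (leq_card_setU _ _); apply/subset_leq_card/subsetP=> u.
  rewrite !inE => /andP[-> /existsP[i]] /=.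
  rewrite -hsV -{1}(cat_take_drop k s) mem_cat => /orP[] ui; apply/orP; [left|right];
    by apply/existsP; exists i.
rewrite touch_V => /(leq_trans le_2p); rewrite mul2n -addnn => le_pp.
by rewrite -(leq_add2l p) (leq_trans le_pp) // leq_add2r.
Qed.

(** * Induction on the weight of a subtree *)

Definition matchable n (w : TV h) k :=
  [/\ k <= size s, balanced k (subtree w) & exists M, packing k (subtree w) M /\ n <= #|M|].

(** Moving the cut from [ka] up to [kb] only enlarges the prefix over [a], and moving it from [kc]
    down to [kb] only enlarges the suffix over [c]. Balance at [a] and [c] thus yields [p] crossing
    edges outside [subtree b], and balance at [w]. *)
Lemma middle_matchable n (a b c w : TV h) ka kb kc :
  a \in subtree w -> b \in subtree w -> c \in subtree w -> b != w ->
  [disjoint subtree a & subtree b] -> [disjoint subtree c & subtree b] -> ka <= kb -> kb <= kc ->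
  matchable n a ka -> matchable n b kb -> matchable n c kc ->
  matchable (n + p) w kb.
Proof.
move=> aw bw cw nbw dab dcb kab kbc [_ /andP[Aa _] _] [kbs _ [M [pM cM]]].
move=> [_ /andP[_ Bc] _].
have sw x : x \in subtree w -> subtree x \subset subtree w.
  by move=> xw; apply/subsetP=> u ux; apply: subtree_trans ux xw.
have sD x : x \in subtree w -> [disjoint subtree x & subtree b] -> subtree x \subset subtree w :\: subtree b.
  by move=> xw dx; rewrite subsetD sw.
have Aw := leq_trans Aa (touch_take_le kab (sD a aw dab)).
have Bw := leq_trans Bc (touch_drop_le kbc (sD c cw dcb)).
split=> //.
  apply/andP; split.
    exact: leq_trans Aw (touch_take_le (leqnn _) (subsetDl _ _)).
  exact: leq_trans Bw (touch_drop_le (leqnn _) (subsetDl _ _)).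
have [|M' [pM' cM']] := @crossing_packing kb w _ (mem (take kb s))
    (@supports_take kb) (subtreeD_rooted bw nbw) Aw.
  left; apply: leq_trans Bw _; apply/subset_leq_card/touchS=> // x /=.
  exact: drop_notin_take.
have [pU cU] := packingU (sw b bw) (subsetDl (subtree w) (subtree b)) (disjoint_setDr _ _) pM pM'.
by exists (M :|: M'); split=> //; rewrite cU leq_add.
Qed.

Lemma matchable_ind d (w : TV h) : 2 * p * 4 ^ d <= #|OC V :&: subtree w| ->
  exists k, matchable (p * d.+1) w k.
Proof.
elim: d w => [|d IH] w heavy_w.
  rewrite expn0 muln1 in heavy_w; rewrite muln1; have [k ks bal] := exists_balanced heavy_w.
  exists k; split=> //; case/andP: bal => Aw Bw.
  apply: (@crossing_packing k w _ (mem (take k s)) (@supports_take k) (subtree_rooted w) Aw).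
  left; apply: leq_trans Bw _; apply/subset_leq_card/touchS=> // x /=.
  exact: drop_notin_take.
set n := 2 * p * 4 ^ d in IH.
have le_pn : 2 * p <= n by rewrite leq_pmulr // expn_gt0.
have heavy4 : 4 * n <= #|OC V :&: subtree w| by rewrite (leq_trans _ heavy_w) // expnS; lia.
(* With [n.-1] the strict lower bound reads [n], and the upper bound becomes [3 * n - 2]. As [w]
   weighs at least [4 * n], this excludes [v = w]. *)
have [|v vw /andP[heavy_v light_v]] := @deepest_heavy _ (OC V) w n.-1; first by lia.
have {}heavy_v : n <= #|OC V :&: subtree v| by lia.
have nvw : v != w by apply: contraTneq light_v => ->; lia.
case: (boolP (subtree w :\: subtree v \subset OC V)) => [full | /subsetPn[u uD uV]]; last first.
  have [k [ks /andP[Av Bv] [M [pM cM]]]] := IH v heavy_v.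
  have swv : subtree v \subset subtree w by apply/subsetP=> x xv; apply: subtree_trans xv vw.
  exists k; split=> //.
    by apply/andP; split; [apply: leq_trans Av (touch_take_le _ _)
                          | apply: leq_trans Bv (touch_drop_le _ _)].
  have [||M' [pM' cM']] := @crossing_packing k w _ (mem V)
      (@supports_V k) (subtreeD_rooted vw nvw).
  (* More than [4 * n - 3 * n = n >= 2 * p] vertices of [OC V] remain outside [subtree v]. *)
  - rewrite touch_V.
    have := cardsID (subtree v) (OC V :&: subtree w).
    rewrite -setIA (setIidPr swv) -setIDA => eq_w.
    by rewrite -(leq_add2l #|OC V :&: subtree v|) eq_w; lia.
  - right; exists u => // i; apply: contraNN uV => ui.
    by rewrite inE; apply/existsP; exists i.
  have [pU cU] := packingU swv (subsetDl (subtree w) (subtree v)) (disjoint_setDr _ _) pM pM'.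
  by exists (M :|: M'); split=> //; rewrite cU mulnSr leq_add.
have [a [b [aw bw sa sb]]] := siblings vw nvw.
rewrite /= !inE andbT negb_or => /andP[/andP[nva nvb] nab].
have dis (x y : TV h) : size (word x) = size (word y) -> x != y ->
    [disjoint subtree x & subtree y] /\ [disjoint subtree y & subtree x].
  by move=> sz nxy; split; rewrite disjoint_subtree // eq_sym.
have [dva dav] := dis v a (esym sa) nva.
have [dvb dbv] := dis v b (esym sb) nvb.
have [dab dba] := dis a b (etrans sa (esym sb)) nab.
(* The subtree of a sibling lies in [OC V], so its weight is its size, which is at least that of
   [subtree v]. *)
have heavy x : x \in subtree w -> size (word x) = size (word v) ->
    [disjoint subtree x & subtree v] -> n <= #|OC V :&: subtree x|.
  move=> xw sx dxv; apply: leq_trans (leq_trans heavy_v (subset_leq_card (subsetIr _ _))) _.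
  rewrite (setIidPr _); first exact: card_subtree_le.
  apply: subset_trans full; rewrite subsetD dxv andbT.
  by apply/subsetP=> y yx; apply: subtree_trans yx xw.
have nw (x : TV h) : size (word x) = size (word v) -> x != w.
  move=> sx; apply: contraNneq nvw => exw; apply/eqP/word_inj.
  by move: vw; rewrite inE -exw prefixE sx take_size => /eqP.
have [kv Mv] := IH v heavy_v.
have [ka Ma] := IH a (heavy a aw sa dav).
have [kb Mb] := IH b (heavy b bw sb dbv).
have mid x y z kx ky kz := @middle_matchable (p * d.+1) x y z w kx ky kz.
rewrite mulnSr.
(* Six of the eight cases are the orders of the three cuts; the other two are contradictory. *)
case: (leqP kv ka) => va; case: (leqP ka kb) => ab; case: (leqP kv kb) => vb.
- by exists ka; apply: (mid v a b kv ka kb) => //; first [exact: nw | exact: ltnW].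
- by have := leq_trans va ab; rewrite leqNgt vb.
- by exists kb; apply: (mid v b a kv kb ka) => //; first [exact: nw | exact: ltnW].
- by exists kv; apply: (mid b v a kb kv ka) => //; first [exact: nw | exact: ltnW].
- by exists kv; apply: (mid a v b ka kv kb) => //; first [exact: nw | exact: ltnW].
- by exists kb; apply: (mid a b v ka kb kv) => //; first [exact: nw | exact: ltnW].
- by have := ltn_trans ab va; rewrite ltnNge vb.
- by exists ka; apply: (mid b a v kb ka kv) => //; first [exact: nw | exact: ltnW].
Qed.
End WitnessingMatching.

(** * Arithmetic of [ternary_size] and [tr] *)

Lemma ternary_sizeE k : 2 * ternary_size k + 1 = 3 ^ k.+1.
Proof.
elim: k => [|k IH]; first by rewrite /ternary_size big_ord_recr big_ord0.
rewrite /ternary_size big_ord_recr /= -/(ternary_size k) mulnDr addnAC IH.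
by rewrite (expnS 3 k.+1); lia.
Qed.

(** Shows that the bound [k <= n] in the maximum defining [tr] loses no candidate. *)
Lemma ltn_ternary_size k : k < ternary_size k.
Proof.
elim: k => [|k IH]; first by rewrite /ternary_size big_ord_recr big_ord0.
rewrite /ternary_size big_ord_recr /= -/(ternary_size k) -addn1.
by rewrite leq_add // expn_gt0.
Qed.

Lemma ternary_size_tr n : 0 < n -> ternary_size (tr n) <= n.
Proof.
move=> n_gt0; rewrite /tr; elim/big_ind: _ => // [|i j ? ?].
  by rewrite /ternary_size big_ord_recr big_ord0.
by rewrite /maxn; case: ifP.
Qed.

Lemma ltn_ternary_size_tr n : n < ternary_size (tr n).+1.
Proof.
rewrite ltnNge; apply/negP => le_n.
have lt_n : (tr n).+1 < n.+1.
  by rewrite ltnS ltnW // (leq_trans (ltn_ternary_size _)).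
have := @leq_bigmax_cond 'I_n.+1 [pred k : 'I_n.+1 | ternary_size k <= n] val (Ordinal lt_n) le_n.
by rewrite /= -/(tr n) ltnn.
Qed.

(** Since [tr n >= tr p + 2 * d + 2], the closed form of [ternary_size] gives [2 * n + 1 >= 3 ^ (tr
    n + 1) >= 3 ^ (tr p + 2) * 3 * 9 ^ d], where [3 ^ (tr p + 2) > 2 * p + 1]. *)
Lemma tr_gap p n d : 0 < p <= n -> d.+1 <= (tr n - tr p) %/ 2 -> 2 * p * 4 ^ d <= n.
Proof.
case/andP=> p_gt0 le_pn le_d.
have le_tr : (tr p).+2 + (2 * d).+1 <= (tr n).+1 by lia.
have := leq_pexp2l (isT : 0 < 3) le_tr.
have le_pow : 4 ^ d <= 9 ^ d by case: (d) => // d'; rewrite leq_exp2r.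
have lt_p := ltn_ternary_size_tr p.
have le_n := ternary_size_tr (leq_trans p_gt0 le_pn).
rewrite expnD (expnS 3 (2 * d)) (expnM 3 2) -[3 ^ 2]/9.
move: (4 ^ d) (9 ^ d) le_pow => x y le_xy; rewrite -!ternary_sizeE; nia.
Qed.

(** * Application of the induction at the root of [T] *)

Theorem theorem1 (p h m : nat) (eH : rel 'I_m)
  (hsym : symmetric eH) (hirr : irreflexive eH)
  (hconn : forall i j : 'I_m, connect eH i j)
  (hp : 0 < p) (hm : 2 * p <= m)
  (V : {set TH h m}) (hOC : p <= #|OC V|)
  (s : seq (TH h m)) (hsu : uniq s) (hsV : s =i V) :
  exists M : {set {set TH h m}},
    witnessing (THadj eH) V s M /\
    p * ((tr #|OC V| - tr p) %/ 2) <= #|M|.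
Proof.
case E: ((tr #|OC V| - tr p) %/ 2) => [|d].
  exists set0; rewrite muln0; split=> //; split; last by exists 0; split=> // e; rewrite inE.
  by split=> [e | e1 e2]; rewrite inE.
have [r er] := word_surj (leq0n h : size ([::] : seq 'I_3) <= h).
have sub_r : subtree r = [set: TV h] by apply/setP=> u; rewrite !inE er prefix0s.
have le_pm : p <= m by apply: leq_trans hm; rewrite leq_pmull.
have [|k [ks _ [M [[edgeM disjM] cM]]]] :=
    matchable_ind hconn hp le_pm hsu hsV (d := d) (w := r).
  by rewrite sub_r setIT; apply: tr_gap; rewrite ?E // hp.
exists M; split=> //; split.
  split=> // e /edgeM[a [b [/and4P[ab _ _ _] ->]]].
  by exists a, b.
exists k; split=> // e /edgeM[a [b [/and4P[_ sab _ _] ->]]] u v /setP eq_e.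
have := eq_e u; have := eq_e v; rewrite !inE !eqxx ?orbT.
have sba : supports V s k b a by case/or4P: sab => sab; rewrite /supports sab ?orbT.
(* The two orientations of the edge are immediate; in the remaining cases [u = v], which forces
   [a = b]. *)
move=> /orP[]/eqP ev /orP[]/eqP eu; rewrite eu ev // in eq_e *.
- by have := eq_e b; rewrite !inE eqxx orbT orbb => /esym/eqP eba; rewrite -{2}eba.
- by have := eq_e a; rewrite !inE eqxx orbb => /esym/eqP eab; rewrite -{1}eab.
Qed.
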